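(* Let $c_1,\ldots,c_k$ be integers with $c_1+\ldots+c_k=0$ and $k>2$, and consider the diophantine equation $c_1X_1+\ldots+c_kX_k=0$. Then there exist $a_0,\ldots,a_{k-2}\in\mathbb{N}$ such that for every idempotent ultrafilter $\mathcal{U}$, the linear combination $$\mathcal{V}=a_0\,\mathcal{U}\oplus a_1\,\mathcal{U}\oplus\ldots\oplus a_{k-2}\,\mathcal{U}$$ witnesses the injective partition regularity of the equation, i.e. for every $A\in\mathcal{V}$ there exist pairwise distinct $x_1,\ldots,x_k\in A$ with $c_1x_1+\ldots+c_kx_k=0$.
   Context: $\mathbb{N}$ denotes the positive integers and $\mathbb{N}_0=\mathbb{N}\cup\{0\}$. All ultrafilters are on $\mathbb{N}_0$. For $n\in\mathbb{N}_0$ the principal ultrafilter is $\mathfrak{U}_n=\{A\subseteq\mathbb{N}_0: n\in A\}$. The pseudo-sum of ultrafilters is defined by $A\in\mathcal{U}\oplus\mathcal{V}$ iff $\{n\in\mathbb{N}_0: A-n\in\mathcal{V}\}\in\mathcal{U}$, where $A-n=\{m\in\mathbb{N}_0: m+n\in A\}$; it is associative, so iterated pseudo-sums are written without parentheses. For $h\in\mathbb{N}_0$, $h\,\mathcal{U}$ is the ultrafilter defined by $A\in h\,\mathcal{U}$ iff $\{n: nh\in A\}\in\mathcal{U}$ (so $0\,\mathcal{U}=\mathfrak{U}_0$). An idempotent ultrafilter is a non-principal ultrafilter $\mathcal{U}$ with $\mathcal{U}\oplus\mathcal{U}=\mathcal{U}$.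
   Formalization: The number of nonzero coefficients is assumed to differ from 2; with exactly two nonzero ones, e.g. (1,-1,0), the equation forces two variables to be equal, so the claim is false. *)

(* Defs.v *)
From HB Require Import structures.
From mathcomp Require Import all_boot all_order all_algebra.
From mathcomp Require Import all_classical.

Set Implicit Arguments.
Unset Strict Implicit.
Unset Printing Implicit Defensive.

Import GRing.Theory.

Local Open Scope classical_set_scope.

(* Ultrafilters on N_0 are the F : set_system nat with [UltraFilter F]. The
   operations below are defined on all set systems; [pseudo_sum_ultra] and
   [dilate_ultra] show that they preserve ultrafilters. *)
Definition pseudo_sum (U V : set_system nat) : set_system nat :=
  [set A | U [set n | V [set m | A (m + n)%N]]].

Definition dilate (h : nat) (U : set_system nat) : set_system nat :=
  [set A | U [set n | A (n * h)%N]].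

Definition idempotent_ultrafilter (U : set_system nat) : Prop :=
  [/\ UltraFilter U,
      ~ (exists n : nat, U = principal_filter n) &
      pseudo_sum U U = U].

Lemma pseudo_sumA : associative pseudo_sum.
Proof.
move=> U V W; rewrite /pseudo_sum; apply/funext => A /=.
by under [in RHS]eq_fun do under eq_fun do under eq_fun do rewrite addnA.
Qed.

Lemma principal_filterE (T : Type) (x : T) :
  principal_filter x = [set A | A x].
Proof. by apply/funext => A; apply/propext; exact: principal_filterP. Qed.

Lemma pseudo_sum0l : left_id (principal_filter 0%N) pseudo_sum.
Proof.
move=> U; rewrite principal_filterE /pseudo_sum; apply/funext => A /=.
by under eq_fun do rewrite addn0.
Qed.

Lemma pseudo_sum0r : right_id (principal_filter 0%N) pseudo_sum.
Proof. by move=> U; rewrite principal_filterE. Qed.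

(* Iterated pseudo-sums are thus big operators over this monoid. *)
HB.instance Definition _ := Monoid.isLaw.Build (set_system nat)
  (principal_filter 0%N) pseudo_sum pseudo_sumA pseudo_sum0l pseudo_sum0r.

Lemma ultraI (T : Type) (F : set_system T) :
  ProperFilter F -> (forall A, F A \/ F (~` A)) -> UltraFilter F.
Proof.
move=> PF FC; split=> // G PG FG; rewrite eqEsubset; split=> // A GA.
have [//|/FG GCA] := FC A.
by case: (filter_not_empty G); rewrite -(setICr A); exact: filterI.
Qed.

Lemma dilate_ultra (h : nat) (U : set_system nat) :
  UltraFilter U -> UltraFilter (dilate h U).
Proof.
move=> UU; have -> : dilate h U = fmap (fun n => (n * h)%N) U by [].
by apply: ultraI => A /=; rewrite preimage_setC; exact: in_ultra_setVsetC.
Qed.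

Lemma pseudo_sum_ultra (U V : set_system nat) :
  UltraFilter U -> UltraFilter V -> UltraFilter (pseudo_sum U V).
Proof.
move=> UU UV; apply: ultraI; last first.
  move=> A; have [UA|UA] := in_ultra_setVsetC [set n | V [set m | A (m + n)%N]] UU.
    by left.
  right; apply: filterS UA => n /= nVA.
  by have [|//] := in_ultra_setVsetC [set m | A (m + n)%N] UV.
constructor; rewrite /pseudo_sum.
  move=> /= U0; have [n /= V0] := filter_ex U0.
  exact: (filter_not_empty V V0).
constructor.
- by apply: (@filterE _ U) => n; exact: filterT.
- move=> A B UA UB; apply: (@filterS _ U) (@filterI _ U _ _ _ UA UB) => n /= [VA VB].
  exact: (@filterI _ V _ _ _ VA VB).
- move=> A B AB; apply: (@filterS _ U) => n /=; apply: filterS => m; exact: AB.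
Qed.

Definition injective_PR_witness (k : nat) (c : 'I_k -> int)
    (F : set_system nat) : Prop :=
  forall A : set nat, F A ->
    exists x : 'I_k -> nat,
      [/\ injective x,
          forall i, A (x i) &
          (\sum_(i < k) c i * (x i)%:Z = 0)%R].

(* Main.v *)
(* Write "for U-most n" for a set of n lying in U. Then A belongs to
   b_0 U + ... + b_r U exactly when, for U-most n_0, ..., for U-most n_r,
   b_0 n_0 + ... + b_r n_r lies in A. Since U is idempotent, this pseudo-sum
   does not change when a zero is inserted in the word b_0 ... b_r or a letter
   is repeated. From a_0 ... a_(k-2) one obtains in this way k words of length
   k: word i has a zero inserted at position i, except that the first word
   repeats a_0 and the last one repeats a_(k-2). The k corresponding linear
   forms in n_0, ..., n_(k-1) all take values in A. Combined with the
   coefficients c_i they cancel identically as soon as S_j a_j is independent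
   of j <= k-2, where S_j = c_0 + ... + c_j. When c is nonincreasing and not
   zero, all these S_j are positive, and a_j = prod_(l <> j) S_l works. The
   words are distinct unless all a_j are equal, which happens only when c has
   exactly two nonzero entries; and distinct words give distinct values for
   U-most choices of the n_j because U is not principal. *)
Require Import Defs.
From mathcomp Require Import all_boot all_order all_algebra.
From mathcomp Require Import all_classical.
From mathcomp Require Import zify.

Import Order.TTheory GRing.Theory Num.Theory.

Local Open Scope classical_set_scope.

(** * Dilations and non-principality *)

Lemma dilate0 (U : set_system nat) :
  UltraFilter U -> dilate 0 U = principal_filter 0%N.
Proof.
move=> UU; rewrite principal_filterE; apply/funext => A; apply/propext.
rewrite /dilate /=; split.
  by move=> /filter_ex[n]; rewrite /= muln0.
by move=> A0; apply: filterE => n /=; rewrite muln0.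
Qed.

Lemma dilate_idem (U : set_system nat) (h : nat) : pseudo_sum U U = U ->
  pseudo_sum (dilate h U) (dilate h U) = dilate h U.
Proof.
move=> UU; rewrite -[in RHS]UU /pseudo_sum /dilate; apply/funext => A /=.
by under [in RHS]eq_fun do under eq_fun do rewrite mulnDl.
Qed.

Lemma nonprincipal_neq (U : set_system nat) (p : nat) : UltraFilter U ->
  ~ (exists n : nat, U = principal_filter n) -> U [set n | n <> p].
Proof.
move=> UU UN; have [Up|//] := in_ultra_setVsetC [set p] UU.
case: UN; exists p; rewrite principal_filterE; apply/funext => A; apply/propext.
split=> [UA|Ap].
  by have [_ [/= -> ]] := filter_ex (filterI Up UA).
by apply: filterS Up => _ ->.
Qed.

(** * Words, linear forms and iterated ultrafilter quantifiers *)

Definition word_sum (w : seq nat) (U : set_system nat) : set_system nat :=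
  \big[pseudo_sum/principal_filter 0%N]_(a <- w) dilate a U.

Lemma word_sum_cat (w v : seq nat) (U : set_system nat) :
  word_sum (w ++ v) U = pseudo_sum (word_sum w U) (word_sum v U).
Proof. exact: big_cat. Qed.

Lemma word_sum_cons (a : nat) (w : seq nat) (U : set_system nat) :
  word_sum (a :: w) U = pseudo_sum (dilate a U) (word_sum w U).
Proof. exact: big_cons. Qed.

Lemma word_sum1 (a : nat) (U : set_system nat) :
  word_sum [:: a] U = dilate a U.
Proof. exact: big_seq1. Qed.

Definition dot (w s : seq nat) : nat :=
  (\sum_(j < size w) nth 0 w j * nth 0 s j)%N.

Lemma dot_cons (a x : nat) (w s : seq nat) :
  dot (a :: w) (x :: s) = (a * x + dot w s)%N.
Proof. by rewrite /dot big_ord_recl. Qed.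

(** As a set system this is the n-th tensor power of [U], carried by lists of length n. The head of
    the list is bound outermost, matching the order of the pseudo-sum. *)
Fixpoint iter_quant (U : set_system nat) (n : nat) (P : set (seq nat)) : Prop :=
  if n is n'.+1 then U [set x | iter_quant U n' [set s | P (x :: s)]]
  else P [::].

Lemma iter_quant_proper (U : set_system nat) (n : nat) :
  UltraFilter U -> ProperFilter (iter_quant U n).
Proof.
move=> UU; split.
  elim: n => [//|n IH] /= H.
  by have [x] := @filter_ex _ U _ _ H; exact: IH.
elim: n => [|n IH]; split=> //=; first by move=> P Q; apply.
- by apply: (@filterE _ U) => x; exact: (@filterT _ _ IH).
- move=> P Q UP UQ; apply: (@filterS _ U) (@filterI _ U _ _ _ UP UQ) => x [].
  exact: (@filterI _ _ IH).
- by move=> P Q PQ; apply: (@filterS _ U) => x; apply: (@filterS _ _ IH) => s; exact: PQ.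
Qed.

Lemma word_sum_iter_quant (U : set_system nat) (w : seq nat) (A : set nat) :
  UltraFilter U -> word_sum w U A -> iter_quant U (size w) [set s | A (dot w s)].
Proof.
move=> UU; elim: w A => [|a w IH] A.
  by rewrite /word_sum big_nil principal_filterE /= /dot big_ord0.
rewrite word_sum_cons /pseudo_sum /dilate /=; apply: (@filterS _ U) => x /IH.
apply: (@filterS _ _ (@iter_quant_proper U (size w) UU)) => s /=.
by rewrite dot_cons addnC (mulnC a).
Qed.

(** The offsets [p] and [q] collect the terms of the variables already bound, so that induction goes
    through. If the tails differ, any head value works. If they agree, the first letters differ, so
    at most one head value gives equality, and a non-principal [U] avoids it. *)
Lemma iter_quant_dot_neq (U : set_system nat) (w v : seq nat) (p q : nat) :
    UltraFilter U -> ~ (exists n : nat, U = principal_filter n) ->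
    size w = size v -> w <> v ->
  iter_quant U (size w) [set s | (dot w s + p)%N <> (dot v s + q)%N].
Proof.
move=> UU UN; elim: w v p q => [|a w IH] [|b v] p q //= [szwv] neq.
have FQ : Filter (iter_quant U (size w)) by have [] := @iter_quant_proper U (size w) UU.
have [wv|/eqP wv] := eqVneq w v; last first.
  apply: (@filterE _ U) => x; apply: filterS (IH v (a * x + p)%N (b * x + q)%N szwv wv).
  by move=> s /=; rewrite !dot_cons; lia.
have ab : a <> b by move=> ab; apply: neq; rewrite ab wv.
have [[x0 x0E]|nox] := pselect (exists x, (a * x + p = b * x + q)%N); last first.
  apply: (@filterE _ U) => x; apply: (@filterE _ _ FQ) => s /=; rewrite !dot_cons wv => E.
  by apply: nox; exists x; lia.
apply: (@filterS _ U) (nonprincipal_neq U x0 UU UN) => x /= xx0.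
apply: (@filterE _ _ FQ) => s /=; rewrite !dot_cons wv => E.
have : (a * x + p = b * x + q)%N by lia.
nia.
Qed.

Lemma bigcap_ord_filter (T : Type) (F : set_system T) (n : nat)
    (P : nat -> set T) : Filter F -> (forall i, (i < n)%N -> F (P i)) ->
  F [set s | forall i, (i < n)%N -> P i s].
Proof.
move=> FF; elim: n => [|n IH] FP; first exact: filterE.
have FPn := IH (fun i lti => FP i (ltnW lti)).
apply: filterS (filterI FPn (FP n (ltnSn n))) => s [/= sP sPn] i.
by rewrite ltnS leq_eqVlt => /orP[/eqP->|/sP].
Qed.

(** * The words obtained by one insertion *)

Section Words.
Variables (m : nat) (a : nat -> nat).

Let letters := mkseq a m.+1.

(** Doubling the end letter, rather than inserting a zero there, makes the first and last columns of
    the words constant, so these cancel because the coefficients sum to zero. *)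
Definition inserted (i : nat) : nat :=
  if i == 0 then a 0 else if i == m.+1 then a m else 0.

Definition word (i : nat) : seq nat :=
  take i letters ++ inserted i :: drop i letters.

Lemma size_word i : (i <= m.+1)%N -> size (word i) = m.+2.
Proof.
move=> im; rewrite size_cat /= size_takel ?size_mkseq// size_drop size_mkseq.
lia.
Qed.

Lemma nth_word i j : (i <= m.+1)%N -> (j <= m.+1)%N ->
  nth 0 (word i) j =
    if (j < i)%N then a j else if j == i then inserted i else a j.-1.
Proof.
move=> im jm; rewrite nth_cat size_takel ?size_mkseq//.
have [ji|] := ltnP j i; first by rewrite nth_take// nth_mkseq//; lia.
rewrite leq_eqVlt => /orP[/eqP<-|ij]; first by rewrite subnn eqxx.
rewrite gtn_eqF// -[(j - i)%N]prednK ?subn_gt0//= nth_drop nth_mkseq; last lia.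
by congr a; lia.
Qed.

Lemma word_sum_word (U : set_system nat) i :
    UltraFilter U -> pseudo_sum U U = U -> (i <= m.+1)%N ->
  word_sum (word i) U = word_sum letters U.
Proof.
move=> UU idem im; rewrite /word /inserted.
have [->|i0] := eqVneq i 0.
  rewrite take0 drop0 /= /letters /mkseq /= !word_sum_cons.
  by rewrite pseudo_sumA dilate_idem.
have [->|im1] := eqVneq i m.+1.
  rewrite take_oversize ?drop_oversize ?size_mkseq//.
  rewrite /letters mkseqS -cats1 -catA !word_sum_cat !word_sum1.
  by rewrite dilate_idem.
by rewrite word_sum_cat word_sum_cons dilate0// pseudo_sum0l -word_sum_cat cat_take_drop.
Qed.

Lemma word_inj i j : (forall l, (l <= m)%N -> (0 < a l)%N) ->
    (exists2 l, (l <= m)%N & a l <> a 0) ->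
  (i < j)%N -> (j <= m.+1)%N -> word i <> word j.
Proof.
move=> a_gt0 [l lm al] ij jm E.
have nthE h : (h <= m.+1)%N -> nth 0 (word i) h = nth 0 (word j) h by rewrite E.
(* An inner insertion leaves a zero where the other word has a positive letter. *)
have [i0|i0] := eqVneq i 0; last first.
  have := nthE i ltac:(lia); rewrite !nth_word ?ltnn ?eqxx ?ij//; try lia.
  rewrite /inserted (negbTE i0); case: eqP => [|_]; first lia.
  by have := a_gt0 i ltac:(lia); lia.
have [jm1|jm1] := eqVneq j m.+1; last first.
  have := nthE j jm; rewrite !nth_word ?ltnn ?eqxx//; try lia.
  rewrite /inserted (negbTE jm1) i0 ifF ?gtn_eqF; try lia.
  by have := a_gt0 j.-1 ltac:(lia); lia.
(* Only the two end words are left. Comparing them at position [l.+1] gives [a l = a l.+1], so all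
   letters would be equal. *)
apply: al; elim: l lm => // l IH lm; rewrite -IH; last lia.
have := nthE l.+1 ltac:(lia); rewrite !nth_word; try lia.
by rewrite jm1 i0 /= !ltnS lm.
Qed.

(* At each inner position j the coefficients are a (j-1) before j, 0 at j and
   a j after j, so the total is S_(j-1) a_(j-1) - S_j a_j, where S_j is the
   partial sum d_0 + ... + d_j. *)
Lemma word_column (d : nat -> int) (P : int) j :
    (\sum_(0 <= i < m.+2) d i = 0)%R ->
    (forall l, (l <= m)%N -> (\sum_(0 <= i < l.+1) d i) * (a l)%:Z = P)%R ->
    (j <= m.+1)%N ->
  (\sum_(0 <= i < m.+2) d i * (nth 0 (word i) j)%:Z = 0)%R.
Proof.
move=> d0 SP jm.
have constant v : (forall i, (i <= m.+1)%N -> nth 0 (word i) j = v) ->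
    (\sum_(0 <= i < m.+2) d i * (nth 0 (word i) j)%:Z = 0)%R.
  move=> wv; rewrite -[RHS](mul0r (Posz v)) -[X in (_ = X * _)%R]d0 big_distrl /=.
  by apply: eq_big_nat => i /andP[_ im]; rewrite wv.
have [j0|j0] := eqVneq j 0.
  apply: (constant (a 0)) => i im; rewrite nth_word// j0 /inserted.
  by case: i im.
have [jm1|jm1] := eqVneq j m.+1.
  apply: (constant (a m)) => i im; rewrite nth_word// jm1 ltnNge im /= /inserted.
  by case: (eqVneq m.+1 i) => [<-|]; rewrite ?eqxx.
have j1 : j.-1.+1 = j by lia.
have := SP j ltac:(lia); have := SP j.-1 ltac:(lia).
rewrite j1 (@big_nat_recr _ _ _ j)//= => SP1 SP2.
move: d0; rewrite !(@big_cat_nat _ _ _ j 0 m.+2)//=; try lia.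
rewrite !(@big_ltn _ _ _ j)//; try lia.
rewrite nth_word// ltnn eqxx /inserted (negbTE j0) (negbTE jm1) mulr0 add0r.
under [X in (_ -> X + _ = 0)%R]eq_big_nat => i /andP[_ ij].
  rewrite nth_word//; last lia.
  rewrite ltnNge ltnW//= gtn_eqF//; over.
under [X in (_ -> _ + X = 0)%R]eq_big_nat => i /andP[ji im].
  rewrite nth_word// ji; over.
rewrite -!big_distrl /= SP1 => d0.
move: SP2; rewrite -[X in (_ = X -> _)%R]opprK => SP2.
have -> : (\sum_(j.+1 <= i < m.+2) d i = - (\sum_(0 <= i < j) d i + d j))%R.
  by apply/eqP; rewrite -addr_eq0 addrC -addrA d0.
by rewrite mulNr SP2 opprK subrr.
Qed.
End Words.

(** * Solutions read off from the words *)

Lemma words_witness (m : nat) (a : nat -> nat) (d : nat -> int) (P : int)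
    (U : set_system nat) (A : set nat) :
    (forall l, (l <= m)%N -> (0 < a l)%N) ->
    (exists2 l, (l <= m)%N & a l <> a 0) ->
    (\sum_(0 <= i < m.+2) d i = 0)%R ->
    (forall l, (l <= m)%N -> (\sum_(0 <= i < l.+1) d i) * (a l)%:Z = P)%R ->
    idempotent_ultrafilter U -> word_sum (mkseq a m.+1) U A ->
  exists x : nat -> nat,
    [/\ forall i j, (i < j)%N -> (j <= m.+1)%N -> x i <> x j,
        forall i, (i <= m.+1)%N -> A (x i) &
        (\sum_(0 <= i < m.+2) d i * (x i)%:Z = 0)%R].
Proof.
move=> a_gt0 a_neq d0 SP [UU UN idem] VA.
have FQ := iter_quant_proper U m.+2 UU.
have QA i : (i < m.+2)%N -> iter_quant U m.+2 [set s | A (dot (word m a i) s)].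
  move=> im; rewrite -(size_word m a i im); apply: word_sum_iter_quant => //.
  by rewrite word_sum_word.
have Qneq j : (j < m.+2)%N -> iter_quant U m.+2 [set s | forall i, (i < j)%N ->
    dot (word m a i) s <> dot (word m a j) s].
  move=> jm; apply: (bigcap_ord_filter _ _ j (fun i => [set s |
    dot (word m a i) s <> dot (word m a j) s])) => i ij.
  have im : (i <= m.+1)%N by lia.
  have := iter_quant_dot_neq U (word m a i) (word m a j) 0 0 UU UN.
  rewrite !size_word// => /(_ erefl (word_inj m a i j a_gt0 a_neq ij jm)).
  by apply: filterS => s /=; rewrite !addn0.
have [s [/= sA sneq]] := filter_ex (filterI
  (bigcap_ord_filter _ _ _ _ _ QA) (bigcap_ord_filter _ _ _ _ _ Qneq)).
exists (fun i => dot (word m a i) s); split=> [i j ij jm|i im|].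
- exact: sneq.
- exact: sA.
transitivity (\sum_(0 <= i < m.+2) \sum_(j < m.+2)
    d i * (nth 0%N (word m a i) j)%:Z * (nth 0%N s j)%:Z)%R.
  apply: eq_big_nat => i /andP[_ im].
  rewrite /dot size_word// (big_morph Posz PoszD (erefl _)) big_distrr /=.
  by apply: eq_bigr => j _; rewrite PoszM mulrA.
(* Summed column by column, each variable has total coefficient zero. *)
rewrite exchange_big big1//= => j _; rewrite -big_distrl /=.
by rewrite (word_column _ _ _ P)// ?mul0r// -ltnS.
Qed.

(** * Choice of the letters for nonincreasing coefficients *)

Section SortedCoefficients.
Variables (m : nat) (d : nat -> int).
Hypothesis d_sorted : forall i j, (i <= j)%N -> (j <= m.+1)%N -> (d j <= d i)%R.
Hypothesis d_sum0 : (\sum_(0 <= i < m.+2) d i = 0)%R.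

Let S l : int := (\sum_(0 <= i < l.+1) d i)%R.

Let S_tail l : (l <= m)%N -> (S l = - \sum_(l.+1 <= i < m.+2) d i)%R.
Proof.
move=> lm; apply/eqP; rewrite -addr_eq0 -[eqbRHS]d_sum0 /S.
by rewrite -(@big_cat_nat _ _ _ l.+1)//; lia.
Qed.

(** If [d l] is nonnegative, so are all earlier terms, and the first is positive. If it is negative,
    so is every later term, and the partial sum is minus the sum of these. *)
Lemma partial_sum_gt0 l : (0 < d 0%N)%R -> (l <= m)%N -> (0 < S l)%R.
Proof.
move=> d0 lm; have [dl|dl] := lerP 0%R (d l).
  rewrite /S big_ltn// ltr_wpDr// big_nat_cond sumr_ge0// => i.
  by rewrite andbT => /andP[_ il]; apply: le_trans dl _; apply: d_sorted; lia.
rewrite S_tail// oppr_gt0 big_ltn; last lia.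
have dl1 : (d l.+1 < 0)%R by apply: le_lt_trans dl; apply: d_sorted; lia.
rewrite ltr_wnDr// big_nat_cond sumr_le0// => i; rewrite andbT => /andP[li im].
by apply: ltW; apply: le_lt_trans dl; apply: d_sorted; lia.
Qed.

Lemma partial_sum_eq0 l : (d 0%N <= 0)%R -> (l <= m)%N -> S l = 0%R.
Proof.
move=> d0 lm; have d_le0 i : (i <= m.+1)%N -> (d i <= 0)%R.
  by move=> im; apply: le_trans d0; exact: d_sorted.
apply/eqP; rewrite eq_le; apply/andP; split.
  rewrite /S big_nat_cond sumr_le0// => i; rewrite andbT => /andP[_ il].
  by apply: d_le0; lia.
rewrite S_tail// oppr_ge0 big_nat_cond sumr_le0// => i.
by rewrite andbT => /andP[_ im]; apply: d_le0; lia.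
Qed.

Lemma letters_exist : (0 < m)%N ->
    (\sum_(0 <= i < m.+2) (d i != 0%R))%N <> 2 ->
  exists (a : nat -> nat) (P : int),
    [/\ forall l, (l <= m)%N -> (0 < a l)%N,
        exists2 l, (l <= m)%N & a l <> a 0%N &
        forall l, (l <= m)%N -> (S l * (a l)%:Z = P)%R].
Proof.
move=> m_gt0 d_supp; have [d0|d0] := lerP (d 0%N) 0%R.
  (* All partial sums vanish here, so any positive non-constant letters serve. *)
  exists succn, 0%R; split=> //; first by exists 1%N.
  by move=> l lm; rewrite partial_sum_eq0// mul0r.
pose T l := absz (S l).
have TS l : (l <= m)%N -> Posz (T l) = S l.
  by move=> lm; rewrite gez0_abs// ltW// partial_sum_gt0.
have T_gt0 l : (l <= m)%N -> (0 < T l)%N.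
  by move=> lm; rewrite absz_gt0 gt_eqF// partial_sum_gt0.
pose a l := (\prod_(i < m.+1 | i != l :> nat) T i)%N.
pose P := (\prod_(i < m.+1) T i)%N.
have aP l : (l <= m)%N -> (T l * a l = P)%N.
  by move=> lm; rewrite /P (bigD1 (Ordinal (lm : (l < m.+1)%N))).
have P_gt0 : (0 < P)%N by rewrite prodn_gt0// => i; apply: T_gt0; rewrite -ltnS.
exists a, (Posz P); split.
- by move=> l lm; move: P_gt0; rewrite -(aP l lm) muln_gt0 => /andP[].
(* Constant letters force every partial sum to equal [d 0], so exactly the first and last
   coefficients are nonzero. *)
- apply: contrapT => a_const; apply: d_supp.
  have aE l : (l <= m)%N -> a l = a 0%N.
    by move=> lm; apply: contrapT => al; apply: a_const; exists l.
  have TE l : (l <= m)%N -> T l = T 0%N.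
    move=> lm; have := aP l lm; have := aP 0%N (leq0n m); rewrite aE//.
    by move: P_gt0; nia.
  have SE l : (l <= m)%N -> S l = d 0%N.
    by move=> lm; rewrite -TS// TE// TS// /S big_nat1.
  have d_eq0 l : (0 < l <= m)%N -> d l = 0%R.
    case: l => // l /= lm.
    have : S l.+1 = (S l + d l.+1)%R by rewrite /S big_nat_recr.
    by rewrite !SE; lia.
  have dm : (d m.+1 = - d 0%N)%R.
    by rewrite -(SE m)// S_tail// big_nat1 opprK.
  rewrite big_nat_recr//= big_ltn// dm oppr_eq0 (gt_eqF d0) big_nat big1// => i.
  by move=> im; rewrite d_eq0 ?eqxx.
- by move=> l lm; rewrite -TS// -PoszM aP.
Qed.

End SortedCoefficients.

(* Zero coefficients are allowed, except that the number of nonzero ones must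
   not be 2: then the equation reads c X_i = c X_j with c <> 0 and has no
   solution with X_i <> X_j. *)
Theorem theorem1p2 (k : nat) (c : 'I_k -> int)
  (hk : (2 < k)%N)
  (hsum : (\sum_(i < k) c i = 0)%R)
  (hc : #|[pred i : 'I_k | c i != 0%R]| <> 2) :
  exists a : 'I_k.-1 -> nat,
    (forall i, (0 < a i)%N) /\
    forall U : set_system nat, idempotent_ultrafilter U ->
      injective_PR_witness c
        (\big[pseudo_sum/principal_filter 0%N]_(i < k.-1) dilate (a i) U).
Proof.
case: k c hk hsum hc => [|[|m]] // c hk hsum hc.
(* Sorting makes the coefficients nonincreasing; the solution is carried back along positions in
   [s]. *)
pose s := sort (fun i j => c j <= c i)%R (enum 'I_m.+2).
pose d l := c (nth ord0 s l).
have s_enum : perm_eq s (index_enum 'I_m.+2).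
  by rewrite perm_sort enumT.
have size_s : size s = m.+2 by rewrite size_sort size_enum_ord.
have uniq_s : uniq s by rewrite sort_uniq enum_uniq.
have mem_s i : i \in s by rewrite mem_sort mem_enum.
have index_s i : (index i s < m.+2)%N by rewrite -[ltnRHS]size_s index_mem.
have d_sorted i j : (i <= j)%N -> (j <= m.+1)%N -> (d j <= d i)%R.
  move=> ij jm; apply: (@sorted_leq_nth _ (fun i j => c j <= c i)%R) => //.
  - by move=> x y z xy yz; exact: le_trans yz xy.
  - by apply: sort_sorted => x y; exact: le_total.
  - by rewrite inE size_s; exact: leq_ltn_trans ij (jm : (j < m.+2)%N).
  - by rewrite inE size_s.
have d_sum0 : (\sum_(0 <= i < m.+2) d i = 0)%R.
  by rewrite -[RHS]hsum -(perm_big _ s_enum) (big_nth ord0) size_s.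
have d_supp : (\sum_(0 <= i < m.+2) (d i != 0%R))%N <> 2.
  move=> E; apply: hc; rewrite -E -sum1_card big_mkcond /=.
  by rewrite -(perm_big _ s_enum) (big_nth ord0) size_s.
have [a [P [a_gt0 a_neq SP]]] := letters_exist m d d_sorted d_sum0 hk d_supp.
exists (fun i => a i); split=> [i|U UI A VA]; first by apply: a_gt0; rewrite -ltnS.
have [|x [x_neq xA x_sum]] := words_witness m a d P U A a_gt0 a_neq d_sum0 SP UI.
  by move: VA; rewrite -(big_mkord xpredT (fun i => dilate (a i) U)) /index_iota subn0
    /word_sum /mkseq big_map.
exists (fun i => x (index i s)); split=> [i j xij|i|].
- apply: (@index_inj _ ord0 s) => //.
  have := index_s i; have := index_s j; rewrite !ltnS => jm im.
  by case: (ltngtP (index i s) (index j s)) => // /x_neq; rewrite xij => /(_ _)[].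
- by apply: xA; rewrite -ltnS.
rewrite -[RHS]x_sum -(perm_big _ s_enum) (big_nth ord0) size_s /=.
by apply: eq_big_nat => i im; rewrite index_uniq ?size_s.
Qed.
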